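(* For every integer $n\ge3$, $$k(H_{n^2})=12\,\nu(n)+12\,\widetilde{R}(n),$$ and $k(H_4)=12\,\nu(2)+24\,\widetilde{R}(2)=60$. In particular $12\mid k(H_{n^2})$ for every $n\ge2$.
   Context: Let $\mathbb{H}_2$ be the Siegel upper half-space of degree two, with points $\tau=\begin{pmatrix}\tau_1&z\\ z&\tau_2\end{pmatrix}$, and $\mathcal{A}_2=\mathbb{H}_2/\mathrm{Sp}_4(\mathbb{Z})$. For $D>0$, $D\equiv 0,1\pmod 4$, the Humbert surface $H_D\subset\mathcal{A}_2$ is the irreducible divisor whose preimage in $\mathbb{H}_2$ is the union over all primitive $(a,b,c,d,e)\in\mathbb{Z}^5$ with $b^2-4ac-4de=D$ of the loci $a\tau_1+bz+c\tau_2+d(z^2-\tau_1\tau_2)+e=0$. An exact Humbert form $G_D$ is a scalar Siegel modular form for $\mathrm{Sp}_4(\mathbb{Z})$ with divisor (on $\mathcal{A}_2$) exactly $H_D$; it exists and is unique up to a nonzero scalar; $k(H_D)$ denotes its weight. One has $k(H_1)=10$. Known description of these weights (van der Geer, recalled in the paper): for every $n\ge1$, $$\sum_{m\mid n}v(m^2)\,k(H_{m^2})=\tfrac12 a_{n^2},\qquad v(m^2)=\tfrac12\text{ if }m\in\{1,2\},\quad v(m^2)=1\text{ if }m\ge3,$$ where $a_{n^2}=24\sum_{x}\sigma_1\bigl(\tfrac{n^2-x^2}{4}\bigr)+12n^2-2$, the sum over $x\in\mathbb{Z}$ with $(n^2-x^2)/4$ a positive integer, and $\sigma_1(N)=\sum_{d\mid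 N}d$. $\varphi$ is Euler's function, $\psi(N)=N\prod_{p\mid N}(1+1/p)$ the Dedekind psi function ($\psi(1)=1$); $\nu(2)=3$ and $\nu(n)=\frac12\varphi(n)\psi(n)$ for $n\ge3$. For $n\ge1$, $$\widetilde{R}(n)=\sum_{\substack{x\in\mathbb{Z},\ |x|<n\\ x\equiv n\ (\mathrm{mod}\ 2)}}\ \sum_{\substack{u\ge1,\ \gcd(u,x)=1\\ u^2\mid (n^2-x^2)/4}}\psi\Bigl(\frac{n^2-x^2}{4u^2}\Bigr),$$ with the convention $\gcd(u,0)=u$ (both signs of $x$ occur, $x=0$ once). *)

(* Defs.v *)
From HB Require Import structures.
From mathcomp Require Import all_boot all_order all_algebra.
From mathcomp Require Import complex.
From mathcomp Require Import all_classical all_reals all_analysis.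

Set Implicit Arguments.
Unset Strict Implicit.
Unset Printing Implicit Defensive.

Import Order.TTheory GRing.Theory Num.Theory.
Import numFieldNormedType.Exports.

Local Open Scope classical_set_scope.
Local Open Scope complex_scope.
Local Open Scope card_scope.
Local Open Scope ring_scope.

(* R[i], packaged so that its topology and norm are inferred. *)
Definition Cx (R : realType) : numClosedFieldType := R[i].

Definition siegel_H2 (R : realType) : set 'M[Cx R]_2 :=
  [set tau | tau^T = tau /\
     forall x : 'cV[R]_2, x != 0 ->
       0 < (x^T *m map_mx (@complex.Im R) tau *m x) 0 0].

Definition symp_form : 'M[int]_(2 + 2) := block_mx 0 1%:M (- 1%:M) 0.

Definition Sp4Z : set 'M[int]_(2 + 2) :=
  [set M | M^T *m symp_form *m M = symp_form].

Definition automorphy_mx (R : realType) (M : 'M[int]_(2 + 2))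
    (tau : 'M[Cx R]_2) : 'M[Cx R]_2 :=
  map_mx intr (dlsubmx M) *m tau + map_mx intr (drsubmx M).

Definition Sp4_act (R : realType) (M : 'M[int]_(2 + 2))
    (tau : 'M[Cx R]_2) : 'M[Cx R]_2 :=
  (map_mx intr (ulsubmx M) *m tau + map_mx intr (ursubmx M))
    *m invmx (automorphy_mx M tau).

Definition sym_mx2 (R : realType) (p : 'rV[Cx R]_3) : 'M[Cx R]_2 :=
  \matrix_(i < 2, j < 2) p 0 (inord (i + j)%N).

(* Functions live on all of 'M_2 but only their values on the open set
   [siegel_H2] of the 3-dimensional space of symmetric matrices matter, so
   complex differentiability is taken in the coordinates (tau_1, z, tau_2). *)
Definition holomorphic_H2 (R : realType) (F : 'M[Cx R]_2 -> Cx R) : Prop :=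
  forall p : 'rV[Cx R]_3, siegel_H2 (sym_mx2 p) ->
    differentiable (F \o @sym_mx2 R : 'rV[Cx R]_3 -> (Cx R)^o) p.

(* No condition at the cusps is needed in degree two (Koecher principle). *)
Definition siegel_modular_form (R : realType) (k : int)
    (F : 'M[Cx R]_2 -> Cx R) : Prop :=
  holomorphic_H2 F /\
  forall M tau, Sp4Z M -> siegel_H2 tau ->
    F (Sp4_act M tau) = \det (automorphy_mx M tau) ^ k * F tau.

Record humbert_vec := HumbertVec { hv_a : int; hv_b : int; hv_c : int;
                                   hv_d : int; hv_e : int }.

Definition hv_primitive (v : humbert_vec) : Prop :=
  gcdz (hv_a v) (gcdz (hv_b v) (gcdz (hv_c v) (gcdz (hv_d v) (hv_e v)))) = 1.

Definition hv_disc (v : humbert_vec) : int :=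
  hv_b v ^+ 2 - 4 * hv_a v * hv_c v - 4 * hv_d v * hv_e v.

Definition humbert_eqn (R : realType) (v : humbert_vec)
    (tau : 'M[Cx R]_2) : Cx R :=
  let tau1 := tau 0 0 in let z := tau 0 1 in let tau2 := tau 1 1 in
  (hv_a v)%:~R * tau1 + (hv_b v)%:~R * z + (hv_c v)%:~R * tau2
  + (hv_d v)%:~R * (z ^+ 2 - tau1 * tau2) + (hv_e v)%:~R.

Definition humbert_locus (R : realType) (v : humbert_vec) : set 'M[Cx R]_2 :=
  [set tau | siegel_H2 tau /\ humbert_eqn v tau = 0].

Definition humbert_preimage (R : realType) (D : nat) : set 'M[Cx R]_2 :=
  [set tau | exists v : humbert_vec,
     [/\ hv_primitive v, hv_disc v = D%:Z & humbert_locus v tau]].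

(* Vanishing order of F along one component of the preimage in H_2: the locus
   is irreducible and [humbert_eqn v] is a reduced equation of it, its gradient
   being nowhere zero on H_2 when the discriminant is positive. *)
Definition order_along (R : realType) (v : humbert_vec)
    (F : 'M[Cx R]_2 -> Cx R) (m : nat) : Prop :=
  exists g : 'M[Cx R]_2 -> Cx R,
    [/\ holomorphic_H2 g,
        forall tau, siegel_H2 tau -> F tau = humbert_eqn v tau ^+ m * g tau
      & exists2 tau, humbert_locus v tau & g tau != 0].

Definition inertia (R : realType) (v : humbert_vec) : set 'M[int]_(2 + 2) :=
  [set M | Sp4Z M /\
     forall tau : 'M[Cx R]_2, humbert_locus v tau -> Sp4_act M tau = tau].

(* The quotient map H_2 -> A_2 is ramified along a component with index the
   order e of its inertia group in Sp_4(Z)/{1,-1}, and orders on H_2 are e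
   times orders on A_2.  Here e = 2 for discriminants 1 and 4, and e = 1
   otherwise; e.g. the cusp form chi_10 has order 2 along z = 0 in H_2 and
   order 1 along H_1 in A_2. *)
Definition order_along_A2 (R : realType) (v : humbert_vec)
    (F : 'M[Cx R]_2 -> Cx R) (m : nat) : Prop :=
  exists e : nat, inertia R v #= `I_(2 * e)%N /\ order_along v F (e * m)%N.

Definition exact_humbert_form (R : realType) (D : nat) (k : int)
    (F : 'M[Cx R]_2 -> Cx R) : Prop :=
  [/\ siegel_modular_form k F,
      forall tau, siegel_H2 tau -> (F tau = 0 <-> humbert_preimage D tau)
    & forall v, hv_primitive v -> hv_disc v = D%:Z -> order_along_A2 v F 1].

(* k(H_D): the value 0 is a placeholder for a D without exact Humbert form. *)
Definition humbert_weight (R : realType) (D : nat) : int :=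
  xget 0 [set k : int | exists F : 'M[Cx R]_2 -> Cx R,
                          exact_humbert_form D k F].

Definition sigma1 (N : nat) : nat := (\sum_(d <- divisors N) d)%N.

Definition dedekind_psi (N : nat) : rat :=
  N%:R * \prod_(p <- primes N) (1 + p%:R^-1).

Definition humbert_v (D : nat) : rat := if D \in [:: 1; 4]%N then 2^-1 else 1.

(* [:: - n, ..., n] *)
Definition int_range (n : nat) : seq int :=
  [seq i%:Z - n%:Z | i <- iota 0 (2 * n)%N.+1].

(* (n^2 - x^2) / 4; used only where this is a positive integer. *)
Definition quarter (n : nat) (x : int) : nat :=
  `|((n%:Z ^+ 2 - x ^+ 2) %/ 4)%Z|%N.

(* a_{n^2} *)
Definition a_sq (n : nat) : rat :=
  24 * (\sum_(x <- int_range n |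
           (0 < n%:Z ^+ 2 - x ^+ 2) && (4 %| n%:Z ^+ 2 - x ^+ 2)%Z)
          sigma1 (quarter n x))%:R
  + 12 * n%:R ^+ 2 - 2.

Definition nu (n : nat) : rat :=
  if n == 2%N then 3 else 2^-1 * (totient n)%:R * dedekind_psi n.

Definition Rtilde (n : nat) : rat :=
  \sum_(x <- int_range n | (`|x| < n%:Z) && (x == n%:Z %[mod 2])%Z)
    \sum_(1 <= u < (quarter n x).+1 |
            coprime u `|x|%N && (u ^ 2 %| quarter n x)%N)
      dedekind_psi (quarter n x %/ u ^ 2)%N.

(* A known theorem on Siegel modular forms, not proved here: the sum of
   v(m^2) k(H_{m^2}) over the divisors m of n equals a_{n^2} / 2. *)
Definition van_der_Geer_formula (R : realType) : Prop :=
  forall n : nat, (0 < n)%N ->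
    \sum_(m <- divisors n) humbert_v (m ^ 2)%N * (humbert_weight R (m ^ 2)%N)%:~R
    = 2^-1 * a_sq n.

(* Main.v *)
Require Import Defs.
From mathcomp Require Import all_boot all_order all_algebra.
From mathcomp Require Import all_classical all_reals all_analysis.
From mathcomp Require Import zify ring lra.

(* Write L(n) = 6 phi(n) psi(n) + 12 Rtilde(n).  Since k(H_1) = 10, van der
   Geer's formula determines all the weights by Moebius inversion, and they
   are the asserted ones once the divisor sum of L at n is a_{n^2} / 2 + 1.
   The first term of L contributes 6 n^2, because phi psi has divisor sum n^2.
   For the second one, sigma_1(N) is the sum of psi(N / w^2) over w^2 | N, and
   a pair (x, w) with 4 w^2 | n^2 - x^2 is d = gcd(w, x) times a pair (y, u)
   with gcd(u, y) = 1 and 4 u^2 | m^2 - y^2, where n = d m.  Then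
   (n^2 - x^2) / (4 w^2) = (m^2 - y^2) / (4 u^2), so grouping the pairs (x, w)
   by d turns the sum of sigma_1 into the divisor sum of Rtilde. *)

Local Open Scope ring_scope.

Import Order.TTheory GRing.Theory Num.Theory.

(** * Induction along coprime factorizations and divisor sums *)

(** Splitting off the full power of the least prime factor leaves a coprime and strictly smaller
    cofactor. *)
Lemma multiplicative_ind (P : nat -> Prop) :
  P 1%N -> (forall p k, prime p -> P (p ^ k.+1)%N) ->
  (forall a b, (0 < a)%N -> (0 < b)%N -> coprime a b -> P a -> P b ->
     P (a * b)%N) ->
  forall n, (0 < n)%N -> P n.
Proof.
move=> P1 Pp PM n; have [m] := ubnP n; elim: m n => // m IHm n lt_nm n_gt0.
have [n_gt1|n_le1] := ltnP 1 n; last first.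
  by have -> : n = 1%N by apply/eqP; rewrite eqn_leq n_le1.
set p := pdiv n; have p_pr : prime p by apply: pdiv_prime.
have lp : (0 < logn p n)%N by rewrite logn_gt0 mem_primes p_pr n_gt0 pdiv_dvd.
rewrite -(partnC p n_gt0); apply: PM; rewrite ?part_gt0 ?coprime_partC //.
  by rewrite p_part -(prednK lp); apply: Pp.
apply: IHm; rewrite ?part_gt0 //.
have : (1 < n`_p)%N by rewrite p_part -{1}(expn0 p) ltn_exp2l // prime_gt1.
have := partnC p n_gt0; have := part_gt0 (p^')%N n; nia.
Qed.

Lemma gcdn_mul_coprime (a b d : nat) :
  coprime a b -> (d %| a * b)%N -> (gcdn d a * gcdn d b = d)%N.
Proof.
move=> cab dab; apply/eqP; rewrite eqn_dvd; apply/andP; split.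
  rewrite Gauss_dvd ?dvdn_gcdl //.
  by apply: coprime_dvdl (dvdn_gcdr _ _) _; apply: coprime_dvdr (dvdn_gcdr _ _) _.
by rewrite muln_gcdr !muln_gcdl !dvdn_gcd dab !(dvdn_mulr _ (dvdnn d))
  (dvdn_mull _ (dvdnn d)).
Qed.

Lemma gcdn_mul_dvd (a b d e : nat) :
  coprime a b -> (d %| a)%N -> (e %| b)%N -> gcdn (d * e) a = d.
Proof.
move=> cab da eb; rewrite gcdnC Gauss_gcdl; first by apply/gcdn_idPr.
exact: coprime_dvdr eb cab.
Qed.

(** Multiplication is a bijection from pairs of divisors onto divisors of the product: [gcdn] with
    [a] and with [b] recovers the two factors. *)
Lemma big_divisors_coprime (V : nmodType) (F : nat -> V) (a b : nat) :
  (0 < a)%N -> (0 < b)%N -> coprime a b ->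
  \sum_(d <- divisors (a * b)) F d =
  \sum_(d <- divisors a) \sum_(e <- divisors b) F (d * e)%N.
Proof.
move=> a0 b0 cab; have ab0 : (0 < a * b)%N by rewrite muln_gt0 a0.
rewrite -(big_allpairs_dep (h := fun d e => (d * e)%N)) /=.
apply/perm_big/uniq_perm.
- exact: divisors_uniq.
- apply: allpairs_uniq; rewrite ?divisors_uniq // => -[d e] [d' e'].
  move=> /allpairsP[[x y]] [/= xa yb [-> ->]] /allpairsP[[x' y']] [/= xa' yb' [-> ->]].
  rewrite -!dvdn_divisors // in xa yb xa' yb' * => exy.
  congr pair.
    by rewrite -(gcdn_mul_dvd a b x y) // exy (gcdn_mul_dvd a b x' y').
  rewrite -(gcdn_mul_dvd b a y x) 1?coprime_sym // mulnC exy mulnC.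
  by rewrite (gcdn_mul_dvd b a) // coprime_sym.
- move=> d; rewrite -dvdn_divisors //; apply/idP/allpairsP => [dab|].
    exists (gcdn d a, gcdn d b); rewrite -!dvdn_divisors //= !dvdn_gcdr.
    by rewrite gcdn_mul_coprime.
  by move=> [[x y]] [/=]; rewrite -!dvdn_divisors // => xa yb ->; apply: dvdn_mul.
Qed.

Lemma big_divisors_pfactor (V : nmodType) (F : nat -> V) (p k : nat) :
  prime p ->
  \sum_(d <- divisors (p ^ k)) F d = \sum_(0 <= i < k.+1) F (p ^ i)%N.
Proof.
move=> p_pr; have p1 := prime_gt1 p_pr.
have pk0 : (0 < p ^ k)%N by rewrite expn_gt0 prime_gt0.
rewrite -(big_map (fun i => p ^ i)%N xpredT); apply/perm_big/uniq_perm.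
- exact: divisors_uniq.
- by rewrite map_inj_uniq ?iota_uniq //; apply: expnI.
- move=> d; rewrite -dvdn_divisors //; apply/(dvdn_pfactor _ _ p_pr)/mapP.
    by move=> [i ik ->]; exists i; rewrite // mem_index_iota ltnS.
  by move=> [i]; rewrite mem_index_iota ltnS => ik ->; exists i.
Qed.

(** * Arithmetic of the Dedekind psi function and the totient *)

Lemma dedekind_psi1 : dedekind_psi 1 = 1.
Proof. by rewrite /dedekind_psi big_nil mulr1. Qed.

Lemma dedekind_psiM (a b : nat) : (0 < a)%N -> (0 < b)%N -> coprime a b ->
  dedekind_psi (a * b)%N = dedekind_psi a * dedekind_psi b.
Proof.
move=> a0 b0 cab; rewrite /dedekind_psi.
have ab : perm_eq (primes (a * b)) (primes a ++ primes b).
  apply: uniq_perm; rewrite ?primes_uniq //.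
    by rewrite cat_uniq !primes_uniq -coprime_has_primes // cab.
  by move=> p; rewrite mem_cat primesM.
by rewrite (perm_big _ ab) big_cat natrM mulrACA.
Qed.

Lemma dedekind_psi_pfactor (p k : nat) : prime p ->
  dedekind_psi (p ^ k.+1)%N = (p.+1 * p ^ k)%:R.
Proof.
move=> p_pr; rewrite /dedekind_psi primesX // primes_prime // big_seq1.
have p0 : (p%:R : rat) != 0 by rewrite pnatr_eq0 -lt0n prime_gt0.
rewrite expnS !natrM -[p.+1]addn1 natrD; field.
exact: p0.
Qed.

Lemma dedekind_psi_nat (N : nat) : exists m : nat, dedekind_psi N = m%:R.
Proof.
case: (posnP N) => [->|]; first by exists 0%N; rewrite /dedekind_psi mul0r.
move: N; apply: multiplicative_ind => [|p k p_pr|a b a0 b0 cab [r ea] [s eb]].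
- by exists 1%N; rewrite dedekind_psi1.
- by eexists; apply: dedekind_psi_pfactor.
- by exists (r * s)%N; rewrite dedekind_psiM // natrM ea eb.
Qed.

(** An odd prime factor p contributes the even factor p - 1; without one, n is a power of 2 that is
    at least 4. *)
Lemma totient_even (n : nat) : (2 < n)%N -> ~~ odd (totient n).
Proof.
move=> n_gt2; have n_gt0 : (0 < n)%N by lia.
have [[p p_pr /andP[pn p_odd]]|no] := pselect (exists2 p, prime p & (p %| n)%N && odd p).
  have lp : (0 < logn p n)%N by rewrite logn_gt0 mem_primes p_pr n_gt0.
  rewrite -(partnC p n_gt0) totient_coprime ?coprime_partC // p_part.
  by rewrite totient_pfactor // !oddM -subn1 oddB ?prime_gt0 // p_odd.
have n2 : (2%N).-nat n.
  apply/pnatP => // p p_pr pn; rewrite inE; apply/eqP.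
  by case: (even_prime p_pr) => // p_odd; case: no; exists p => //; rewrite pn.
rewrite -(part_pnat_id n2) p_part in n_gt2 *.
case: (logn 2%N n) n_gt2 => [|[|k]] // _.
by rewrite totient_pfactor //= mul1n expnS oddM.
Qed.

(** Both sides are multiplicative, and on prime powers the sum telescopes: at p^(k+1) the summand is
    p^(2k+2) - p^(2k). *)
Lemma sum_totient_psi (n : nat) : (0 < n)%N ->
  \sum_(d <- divisors n) (totient d)%:R * dedekind_psi d = n%:R ^+ 2.
Proof.
move: n; apply: multiplicative_ind => [|p k p_pr|a b a0 b0 cab ea eb].
- by rewrite big_seq1 dedekind_psi1 mulr1.
- rewrite big_divisors_pfactor // big_nat_recl // expn0 dedekind_psi1.
  (* Writing the prime as [q.+1] turns its predecessor in the totient into [q], so no truncated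
     subtraction remains. *)
  have p0 := prime_gt0 p_pr; case: p p_pr p0 => // q p_pr _.
  elim: k => [|k IHk].
    rewrite big_nat1 totient_pfactor // dedekind_psi_pfactor // !expn0 expn1 !muln1 /=.
    rewrite mulr1 -!natrM -natrD -natrX; congr (_%:R).
    by rewrite (_ : totient 1 = 1%N) // /= -mulnn; lia.
  rewrite big_nat_recr //= addrA IHk totient_pfactor // dedekind_psi_pfactor //.
  rewrite !expnS -!natrM -!natrX -natrD; congr (_%:R) => /=.
  by set x := (q.+1 ^ k)%N; rewrite !expnS !expn0; ring.
- rewrite big_divisors_coprime // natrM exprMn -ea -eb big_distrl /=.
  apply: eq_big_seq => d; rewrite -dvdn_divisors // => da; rewrite big_distrr /=.
  apply: eq_big_seq => e; rewrite -dvdn_divisors // => eb'.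
  have cde := coprime_dvdl da (coprime_dvdr eb' cab).
  by rewrite totient_coprime // dedekind_psiM ?(dvdn_gt0 _ da) ?(dvdn_gt0 _ eb') // natrM mulrACA.
Qed.

(** * The divisor sum sigma_1 in terms of psi *)

(** Induction in steps of two: from p^k to p^(k+2) the left side gains p^(k+2) + p^(k+1) =
    psi(p^(k+2)), which is the term w = 1 on the right; the other w are p times those for p^k. *)
Lemma sigma1_sum_psi_pfactor (p k : nat) : prime p ->
  \sum_(d <- divisors (p ^ k)) d%:R =
  \sum_(w <- divisors (p ^ k) | (w ^ 2 %| p ^ k)%N)
     dedekind_psi (p ^ k %/ w ^ 2)%N.
Proof.
move=> p_pr; have p1 := prime_gt1 p_pr; have p0 := prime_gt0 p_pr.
rewrite [RHS]big_mkcond !big_divisors_pfactor //.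
have [m] := ubnP k; elim: m k => // m IHm k lt_km.
rewrite [RHS](eq_bigr (fun i => if (i.*2 <= k)%N then
    dedekind_psi (p ^ (k - i.*2))%N else 0)); last first.
  move=> i _; rewrite -expnM muln2 dvdn_Pexp2l //; case: ifP => // ik.
  by rewrite -expnB.
case: k lt_km => [|[|k]] lt_km.
- by rewrite !big_nat1 /= dedekind_psi1.
- rewrite !big_nat_recr //= !big_geq // !add0r addr0 subn0 dedekind_psi_pfactor //.
  by rewrite -natrD; congr (_%:R); lia.
rewrite [RHS]big_nat_recl //= subn0 [X in _ = _ + X]big_nat_recr //= doubleS.
(* The term w = p^(k+2) vanishes, since w^2 does not divide p^(k+2); the shifted range then matches
   the one for k. *)
rewrite [X in _ + (_ + X)]ifF ?addr0; last by lia.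
rewrite [LHS]big_nat_recr //.
rewrite (big_nat_recr k.+1) //= IHm; last by lia.
rewrite dedekind_psi_pfactor // -addrA addrC; congr (_ + _).
  by rewrite -natrD !expnS; congr (_%:R); lia.
apply: eq_bigr => i _; rewrite -expnM muln2 dvdn_Pexp2l // doubleS !ltnS.
by case: ifP => // ik; rewrite -expnB // !subSS.
Qed.

(** Multiplicativity reduces this to prime powers: for coprime a and b with d | a and e | b, (d e)^2
    divides a b exactly when d^2 | a and e^2 | b. *)
Lemma sigma1_sum_psi (N : nat) : (0 < N)%N ->
  (sigma1 N)%:R = \sum_(w <- divisors N | (w ^ 2 %| N)%N)
                     dedekind_psi (N %/ w ^ 2)%N.
Proof.
rewrite /sigma1 natr_sum.
move: N; apply: multiplicative_ind => [|p k p_pr|a b a0 b0 cab ea eb].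
- by rewrite !big_seq1 /= big_cons big_nil /= dedekind_psi1 addr0.
- exact: sigma1_sum_psi_pfactor.
- rewrite big_divisors_coprime // [RHS]big_mkcond big_divisors_coprime //.
  rewrite (eq_bigr (fun d => d%:R * (\sum_(e <- divisors b) e%:R))); last first.
    by move=> d _; rewrite big_distrr; apply: eq_bigr => e _; rewrite natrM.
  rewrite -big_distrl /= ea eb [X in X * _]big_mkcond [X in _ * X]big_mkcond big_distrl /=.
  apply: eq_big_seq => d; rewrite -dvdn_divisors // => da.
  rewrite big_distrr /=.
  apply: eq_big_seq => e; rewrite -dvdn_divisors // => eb'.
  have cde : coprime (d ^ 2) (e ^ 2).
    by rewrite coprime_pexpl // coprime_pexpr // (coprime_dvdl da) // (coprime_dvdr eb').
  rewrite expnMn Gauss_dvd // [X in if X && _ then _ else _]Gauss_dvdl; last first.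
    by rewrite coprime_pexpl // (coprime_dvdl da).
  rewrite Gauss_dvdr; last first.
    by rewrite coprime_sym coprime_pexpr // (coprime_dvdr eb').
  have [d2a|_] /= := boolP (d ^ 2 %| a)%N; last by rewrite mul0r.
  have [e2b|_] /= := boolP (e ^ 2 %| b)%N; last by rewrite mulr0.
  case/dvdnP: d2a => x ax; case/dvdnP: e2b => y bY.
  have d0 := dvdn_gt0 a0 da; have e0 := dvdn_gt0 b0 eb'.
  have -> : (a * b %/ (d ^ 2 * e ^ 2) = x * y)%N.
    by rewrite ax bY mulnACA mulnK // muln_gt0 !expn_gt0 d0 e0.
  have -> : (a %/ d ^ 2 = x)%N by rewrite ax mulnK // expn_gt0 d0.
  have -> : (b %/ e ^ 2 = y)%N by rewrite bY mulnK // expn_gt0 e0.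
  rewrite dedekind_psiM //; try by nia.
  apply: (coprime_dvdl _ (coprime_dvdr _ cab)); by rewrite ?ax ?bY dvdn_mulr.
Qed.

(** * Divisibility of n^2 - x^2 and its behaviour under scaling *)

Lemma mem_int_range (n : nat) (x : int) : (x \in int_range n) = (`|x| <= n%:Z).
Proof.
apply/mapP/idP => [[i]|le_xn]; first by rewrite mem_iota => ? ->; lia.
by exists `|(x + n%:Z)%R|%N; rewrite ?mem_iota; lia.
Qed.

Lemma int_range_uniq (n : nat) : uniq (int_range n).
Proof. by rewrite map_inj_uniq ?iota_uniq // => i j; lia. Qed.

(** The factors n - x and n + x have the same parity, so their product is odd or divisible by 4. *)
Lemma sqr_diff_dvd4 (n : nat) (x : int) :
  (4 %| n%:Z ^+ 2 - x ^+ 2)%Z = (x == n%:Z %[mod 2])%Z.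
Proof.
rewrite eqz_mod_dvd; apply/dvdzP/dvdzP => [[k ek]|[k ek]].
  have [j [ej|ej]] : exists j, x - n%:Z = j * 2 \/ x - n%:Z = j * 2 + 1.
    by exists ((x - n%:Z) %/ 2)%Z; lia.
    by exists j.
  have := ek; have -> : x = n%:Z + j * 2 + 1 by lia.
  nia.
exists (- k * (n%:Z + k)); have -> : x = n%:Z + k * 2 by lia.
by ring.
Qed.

(* Written with [4 * w ^ 2] so that the parity condition on [x] is implied and
   the predicate is visibly homogeneous in [(n, x, w)]. *)
Definition admissible (n : nat) (x : int) (w : nat) : bool :=
  [&& `|x| < n%:Z, (0 < w)%N & (4 * w%:Z ^+ 2 %| n%:Z ^+ 2 - x ^+ 2)%Z].

Lemma sqr_diff_gt0 (n : nat) (x : int) :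
  (0 < n%:Z ^+ 2 - x ^+ 2) = (`|x| < n%:Z).
Proof. by rewrite subr_gt0 -[x ^+ 2]real_normK ?num_real // ltr_pXn2r ?nnegrE. Qed.

(** Trades the integer division inside [quarter] for an explicit cofactor, from which quotients by
    w^2 can be read off. *)
Lemma quarter_div (n : nat) (x : int) (w : nat) (k : int) : (0 < w)%N ->
  n%:Z ^+ 2 - x ^+ 2 = k * (4 * w%:Z ^+ 2) -> quarter n x = (`|k| * w ^ 2)%N.
Proof.
move=> w0 e; rewrite /quarter e.
have -> : k * (4 * w%:Z ^+ 2) = (k * w%:Z ^+ 2) * 4 by ring.
by rewrite mulzK // abszM abszX.
Qed.

Lemma quarter_gt0 (n : nat) (x : int) :
  (`|x| < n%:Z) -> (x == n%:Z %[mod 2])%Z -> (0 < quarter n x)%N.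
Proof.
rewrite -sqr_diff_gt0 -sqr_diff_dvd4 => e /dvdzP[k ek].
rewrite (@quarter_div _ _ 1 k) // ?muln1 ?mulr1 // ?ek //.
by move: e; rewrite ek; lia.
Qed.

Lemma admissibleE (n : nat) (x : int) (w : nat) :
  admissible n x w = [&& `|x| < n%:Z, (x == n%:Z %[mod 2])%Z, (0 < w)%N &
                        (w ^ 2 %| quarter n x)%N].
Proof.
rewrite /admissible; case: (ltP `|x| n%:Z) => //= lt_xn.
case: (posnP w) => //= [|w0]; first by rewrite !andbF.
rewrite -sqr_diff_dvd4; apply/dvdzP/andP => [[k ek]|[/dvdzP[k ek] /dvdnP[j]]].
  split; last by rewrite (@quarter_div _ _ w k) // dvdn_mull.
  by rewrite ek mulrCA dvdz_mulr.
rewrite (@quarter_div _ _ 1 k) // ?muln1 ?mulr1 // => ej.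
(* Positivity of [k] removes the absolute value in [ej]. *)
exists j%:Z; have : 0 < k * 4 by rewrite -ek sqr_diff_gt0.
by rewrite ek => k0; nia.
Qed.

Lemma admissible_scale (d n : nat) (x : int) (w : nat) : (0 < d)%N ->
  admissible (d * n)%N (d%:Z * x) (d * w)%N = admissible n x w.
Proof.
move=> d0; rewrite /admissible normrM muln_gt0 d0 PoszM ltr_pM2l //.
congr [&& _, _ & _]; rewrite PoszM !exprMn -mulrBr mulrCA.
by rewrite dvdz_mul2l // expf_neq0 //; lia.
Qed.

Lemma quarter_scale (d n : nat) (x : int) (w : nat) : (0 < d)%N ->
  admissible n x w ->
  (quarter (d * n) (d%:Z * x) %/ (d * w) ^ 2 = quarter n x %/ w ^ 2)%N.
Proof.
move=> d0 /and3P[_ w0 /dvdzP[k ek]].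
rewrite (@quarter_div n x w k) // (@quarter_div _ _ (d * w)%N k) ?muln_gt0 ?d0 //.
  by rewrite !mulnK // ?expn_gt0 ?muln_gt0 ?d0 ?w0.
by rewrite !PoszM !exprMn -mulrBr ek; ring.
Qed.

(* [d ^ 2] divides both [x ^ 2] and [n ^ 2 - x ^ 2]. *)
Lemma admissible_gcd_dvd (n : nat) (x : int) (w : nat) :
  admissible n x w -> (gcdn w `|x| %| n)%N.
Proof.
move=> /and3P[_ w0 w2]; rewrite -(dvdn_pexp2r _ _ (k := 2)) //.
set d := gcdn _ _; have dx : (d%:Z %| x)%Z by rewrite dvdzE dvdn_gcdr.
have dw : (d%:Z %| w%:Z)%Z by rewrite dvdzE dvdn_gcdl.
have : (d%:Z ^+ 2 %| n%:Z ^+ 2 - x ^+ 2 + x ^+ 2)%Z.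
  rewrite rpredD //; last by rewrite !expr2 dvdz_mul.
  by apply: dvdz_trans w2; rewrite dvdz_mull // !expr2 dvdz_mul.
by rewrite subrK dvdzE !abszX.
Qed.

(** * Index pairs of the two sums and their grouping by gcd *)

(** The inner range copies the one in [Rtilde], whereas [all_pairs] uses divisors as in
    [sigma1_sum_psi]; membership in either is expressed through [admissible]. *)
Definition coprime_pairs (m : nat) : seq (int * nat) :=
  [seq (y, u) | y <- [seq y <- int_range m |
                       (`|y| < m%:Z) && (y == m%:Z %[mod 2])%Z],
                u <- [seq u <- index_iota 1 (quarter m y).+1 |
                       coprime u `|y|%N && (u ^ 2 %| quarter m y)%N]].

Definition all_pairs (n : nat) : seq (int * nat) :=
  [seq (x, w) | x <- [seq x <- int_range n |
                       (`|x| < n%:Z) && (x == n%:Z %[mod 2])%Z],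
                w <- [seq w <- divisors (quarter n x) |
                       (w ^ 2 %| quarter n x)%N]].

Lemma mem_coprime_pairs (m : nat) (y : int) (u : nat) :
  ((y, u) \in coprime_pairs m) = coprime u `|y|%N && admissible m y u.
Proof.
apply/allpairsPdep/andP => [[y' [u' []]]|[cuy]].
  rewrite !mem_filter mem_index_iota => /andP[/andP[ym y2] _].
  move=> /andP[/andP[cuy u2] /andP[u0 _]] [-> ->]; split=> //.
  by rewrite admissibleE ym y2 u0.
rewrite admissibleE => /and4P[ym y2 u0 u2]; exists y, u; split=> //.
  by rewrite mem_filter ym y2 mem_int_range ltW.
(* The upper bound on u is automatic: u divides u^2, hence the positive number [quarter m y]. *)
rewrite mem_filter cuy u2 mem_index_iota u0 ltnS dvdn_leq ?quarter_gt0 //.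
by apply: dvdn_trans u2; rewrite -mulnn dvdn_mulr.
Qed.

Lemma mem_all_pairs (n : nat) (x : int) (w : nat) :
  ((x, w) \in all_pairs n) = admissible n x w.
Proof.
rewrite admissibleE.
apply/allpairsPdep/and4P => [[x' [w' []]]|[xn x2 w0 w2]].
  rewrite !mem_filter => /andP[/andP[xn x2] _] /andP[w2 wq] [-> ->]; split=> //.
  move: wq; rewrite -dvdn_divisors ?quarter_gt0 // => wq.
  by apply: dvdn_gt0 wq; rewrite quarter_gt0.
exists x, w; split=> //; first by rewrite mem_filter xn x2 mem_int_range ltW.
rewrite mem_filter w2 -dvdn_divisors ?quarter_gt0 //.
by apply: dvdn_trans w2; rewrite -mulnn dvdn_mulr.
Qed.

Lemma coprime_pairs_uniq (m : nat) : uniq (coprime_pairs m).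
Proof.
apply: allpairs_uniq_dep => [|y _|[y u] [y' u'] _ _ /= [-> ->] //].
  by rewrite filter_uniq // int_range_uniq.
by rewrite filter_uniq // iota_uniq.
Qed.

Lemma all_pairs_uniq (n : nat) : uniq (all_pairs n).
Proof.
apply: allpairs_uniq_dep => [|y _|[y u] [y' u'] _ _ /= [-> ->] //].
  by rewrite filter_uniq // int_range_uniq.
by rewrite filter_uniq // divisors_uniq.
Qed.

Lemma Rtilde_pairs (m : nat) :
  Rtilde m = \sum_(p <- coprime_pairs m)
               dedekind_psi (quarter m p.1 %/ p.2 ^ 2)%N.
Proof.
rewrite big_allpairs_dep /Rtilde [RHS]big_filter.
by apply: eq_bigr => y _; rewrite [RHS]big_filter.
Qed.

Lemma sum_sigma1_pairs (n : nat) :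
  (\sum_(x <- int_range n |
      (0 < n%:Z ^+ 2 - x ^+ 2) && (4 %| n%:Z ^+ 2 - x ^+ 2)%Z)
      sigma1 (quarter n x))%:R
  = \sum_(p <- all_pairs n) dedekind_psi (quarter n p.1 %/ p.2 ^ 2)%N.
Proof.
rewrite big_allpairs_dep big_filter natr_sum; apply: eq_big => x.
  by rewrite sqr_diff_gt0 sqr_diff_dvd4.
rewrite sqr_diff_gt0 sqr_diff_dvd4 => /andP[xn x2].
by rewrite big_filter sigma1_sum_psi // quarter_gt0.
Qed.

Lemma sum_Rtilde (n : nat) : (0 < n)%N ->
  \sum_(m <- divisors n) Rtilde m =
  (\sum_(x <- int_range n |
      (0 < n%:Z ^+ 2 - x ^+ 2) && (4 %| n%:Z ^+ 2 - x ^+ 2)%Z)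
      sigma1 (quarter n x))%:R.
Proof.
move=> n0; rewrite sum_sigma1_pairs.
have nm0 m : (m %| n)%N -> (0 < n %/ m)%N.
  by move=> mn; rewrite divn_gt0 ?(dvdn_gt0 n0 mn) // dvdn_leq.
under eq_bigr => m _ do rewrite Rtilde_pairs.
rewrite -(big_allpairs_dep (h := fun (m : nat) (p : int * nat) => (m, p))
  (F := fun t => dedekind_psi (quarter t.1 t.2.1 %/ t.2.2 ^ 2)%N)) /=.
set L := [seq _ | _ <- _, _ <- _].
have memL m y u : ((m, (y, u)) \in L) =
    [&& (m %| n)%N, coprime u `|y|%N & admissible m y u].
  apply/allpairsPdep/and3P => [[m' [p [+ + []]]] ? ?|[mn cuy ad]].
    by rewrite -dvdn_divisors // => ?; subst; rewrite mem_coprime_pairs => /andP[].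
  by exists m, (y, u); rewrite -dvdn_divisors // mem_coprime_pairs cuy.
(* Scaling by d = n / m carries a coprime pair of level m to a pair of level n; [h] is shown to be a
   bijection from [L] onto [all_pairs n]. *)
pose h (t : nat * (int * nat)) : int * nat :=
  ((n %/ t.1)%:Z * t.2.1, (n %/ t.1 * t.2.2)%N).
have hL : perm_eq [seq h t | t <- L] (all_pairs n).
  apply: uniq_perm; last first.
  - move=> [x w]; rewrite mem_all_pairs; apply/mapP/idP => [[[m [y u]]]|ad].
      rewrite memL => /and3P[mn _ ad] [-> ->] /=.
      by rewrite -(admissible_scale (n %/ m)) ?nm0 // divnK in ad.
    (* Surjectivity: the preimage of (x, w) has level n / d, where d is the gcd; for x = 0 this d is
       w itself. *)
    have dn := admissible_gcd_dvd n x w ad; set d := gcdn w `|x| in dn.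
    have d0 : (0 < d)%N := dvdn_gt0 n0 dn.
    have w0 : (0 < w)%N by case/and3P: ad.
    have [dw dx] : (d %| w)%N /\ (d%:Z %| x)%Z by rewrite dvdzE dvdn_gcdl dvdn_gcdr.
    have wE : w = (d * (w %/ d))%N by rewrite mulnC divnK.
    have xE : x = d%:Z * (x %/ d%:Z)%Z by rewrite mulrC divzK.
    exists ((n %/ d)%N, ((x %/ d%:Z)%Z, (w %/ d)%N)); last first.
      by rewrite /h /= divnA // mulKn // -wE -xE.
    rewrite memL dvdn_div // -(admissible_scale d) // -wE -xE mulnC divnK // ad andbT.
    have : (d * gcdn (w %/ d) `|(x %/ d%:Z)%Z| = d * 1)%N.
      rewrite muln_gcdr; have -> : (d * `|(x %/ d%:Z)%Z| = `|x|)%N by rewrite {2}xE abszM.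
      by rewrite -wE muln1.
    by move/eqP; rewrite eqn_pmul2l.
  - exact: all_pairs_uniq.
  rewrite map_inj_in_uniq.
    apply: allpairs_uniq_dep => [|m _|[m p] [m' p'] _ _ /= [-> ->] //].
      exact: divisors_uniq.
    exact: coprime_pairs_uniq.
  move=> [m [y u]] [m' [y' u']]; rewrite !memL.
  move=> /and3P[mn cuy ad] /and3P[mn' cuy' ad'] [ey eu].
  (* Injectivity: the gcd of the image coordinates is the scale n / k, which determines the
     level. *)
  have dE k z v : coprime v `|z|%N ->
      gcdn (n %/ k * v)%N `|((n %/ k)%:Z * z)%R|%N = (n %/ k)%N.
    by move=> c; rewrite abszM absz_nat -muln_gcdr (eqP c) muln1.
  have e : (n %/ m = n %/ m')%N by rewrite -(dE m y u) // ey eu dE.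
  have em : m = m'.
    by apply/eqP; rewrite -(eqn_pmul2l (nm0 m mn)) divnK // e divnK.
  move: ey eu; rewrite -em => /mulfI -> //; last by have := nm0 m mn; lia.
  by move/eqP; rewrite eqn_pmul2l ?nm0 // => /eqP ->.
rewrite -(perm_big _ hL) big_map; apply: eq_big_seq => -[m [y u]].
rewrite memL => /and3P[mn _ ad] /=; congr (dedekind_psi _).
by rewrite -(quarter_scale (n %/ m)) ?nm0 // divnK.
Qed.

(** * Inversion of van der Geer's formula *)

(** Uniqueness in Moebius inversion, by strong induction: the terms at proper divisors agree and
    cancel. *)
Lemma divisor_sum_inj (V : zmodType) (F G : nat -> V) :
  (forall n, (0 < n)%N ->
     \sum_(m <- divisors n) F m = \sum_(m <- divisors n) G m) ->
  forall n, (0 < n)%N -> F n = G n.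
Proof.
move=> FG n; have [k] := ubnP n; elim: k n => // k IHk n lt_nk n0.
have := FG n n0; rewrite !(bigD1_seq n) ?divisors_id ?divisors_uniq //=.
rewrite [in LHS]big_seq_cond [in RHS]big_seq_cond (eq_bigr G); first exact: addIr.
move=> m; rewrite -dvdn_divisors // => /andP[mn neq]; apply: IHk.
  by have := dvdn_leq n0 mn; lia.
exact: dvdn_gt0 mn.
Qed.

(** The indicator of n = 1 has constant divisor sum 1, and so accounts for the constant -2 in
    [a_sq], halved. At n = 1 the identity reads k(H_1) / 2 = 5. *)
Lemma humbert_weightE (R : realType) : van_der_Geer_formula R ->
  forall n, (0 < n)%N ->
  humbert_v (n ^ 2)%N * (humbert_weight R (n ^ 2)%N)%:~R =
  6 * ((totient n)%:R * dedekind_psi n) + 12 * Rtilde n - (n == 1%N)%:R.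
Proof.
move=> vdG; apply: divisor_sum_inj => n n0; rewrite vdG //.
rewrite sumrB big_split /= -!mulr_sumr sum_totient_psi // sum_Rtilde //.
rewrite [X in _ - X](bigD1_seq 1%N) ?divisors_uniq ?divisor1 //=.
rewrite [X in _ - (_ + X)]big1 ?addr0; last by move=> m /negbTE ->.
by rewrite /a_sq; field.
Qed.

(** * Integrality, the case n = 2 and the theorem *)

Lemma Rtilde_nat (n : nat) : exists m : nat, Rtilde n = m%:R.
Proof.
rewrite Rtilde_pairs; elim: (coprime_pairs n) => [|p s [m IHs]].
  by exists 0%N; rewrite big_nil.
have [k ek] := dedekind_psi_nat (quarter n p.1 %/ p.2 ^ 2)%N.
by exists (k + m)%N; rewrite big_cons IHs ek natrD.
Qed.

(** For n >= 3 the even totient absorbs the factor 1/2. *)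
Lemma nu_nat (n : nat) : (1 < n)%N -> exists m : nat, nu n = m%:R.
Proof.
rewrite /nu; case: eqP => [_ _|n2 n1]; first by exists 3%N.
have [k ->] := dedekind_psi_nat n; exists ((totient n)./2 * k)%N.
have := odd_double_half (totient n); rewrite (negbTE (totient_even _ _)) ?add0n; last by lia.
by move=> {1}<-; rewrite -muln2 !natrM; field.
Qed.

Lemma Rtilde2 : Rtilde 2 = 1.
Proof.
rewrite Rtilde_pairs.
(* Only x = 0 is even with |x| < 2, and then [quarter 2 0] is 1, which forces u = 1. *)
have -> : coprime_pairs 2 = [:: (0, 1%N)] by [].
by rewrite big_seq1 /= dedekind_psi1.
Qed.

Theorem theorem4p4 (R : realType) (vdG : van_der_Geer_formula R) :
  [/\ forall n : nat, (3 <= n)%N ->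
        (humbert_weight R (n ^ 2)%N)%:~R = 12 * nu n + 12 * Rtilde n,
      (humbert_weight R 4)%:~R = 12 * nu 2 + 24 * Rtilde 2
        /\ 12 * nu 2 + 24 * Rtilde 2 = 60
    & forall n : nat, (2 <= n)%N -> (12 %| humbert_weight R (n ^ 2)%N)%Z].
Proof.
have w3 (n : nat) : (3 <= n)%N ->
    (humbert_weight R (n ^ 2)%N)%:~R = 12 * nu n + 12 * Rtilde n :> rat.
  move=> n3; have := humbert_weightE R vdG n ltac:(lia).
  (* For n >= 3 the square n^2 is neither 1 nor 4, so the factor v is 1. *)
  rewrite /humbert_v /nu ifF; last by rewrite !inE; nia.
  rewrite !ifF; [|lia..]; have -> : (n == 1%N) = false by lia.
  by rewrite mul1r subr0 => ->; field.
have w2 : (humbert_weight R 4)%:~R = 60 :> rat.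
  (* Here v(4) = 1/2 and psi(2) = 3, so half the weight is 6 * 3 + 12 = 30; this halving is why
     [Rtilde 2] has coefficient 24. *)
  have := humbert_weightE R vdG 2 isT; rewrite Rtilde2 (dedekind_psi_pfactor 2 0) //.
  rewrite (_ : totient 2 = 1%N) // /humbert_v /=; lra.
have e60 : 12 * nu 2 + 24 * Rtilde 2 = 60 by rewrite Rtilde2 /nu; lra.
split; [exact: w3 | by rewrite w2 e60 |] => n n2.
have [->|n_neq2] := eqVneq n 2%N.
  have -> : humbert_weight R (2 ^ 2)%N = 60 by apply: (@intr_inj rat).
  by [].
have [[a ea] [b eb]] := (nu_nat n n2, Rtilde_nat n).
(* The rational identity descends to the integers because [nu n] and [Rtilde n] are natural
   numbers. *)
have -> : humbert_weight R (n ^ 2)%N = 12 * (a%:Z + b%:Z).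
  apply: (@intr_inj rat); rewrite w3; last by lia.
  by rewrite ea eb -mulrDr intrM intrD.
exact: dvdz_mulr.
Qed.
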